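(* Let $p$ be an odd prime and let $u\in\mathbb{Z}_p$ with $u(u+1)(3u+1)\not\equiv 0\pmod p$. Let $a_k=\sum_{j=0}^k\binom kj^2\binom{2j}j$. (i) $$\sum_{k=0}^{p-1}\binom{2k}k\Big(\frac u{9(1+u)^2}\Big)^ka_k \equiv\sum_{k=0}^{p-1}\binom{2k}k^2\binom{4k}{2k}\Big(\frac u{9(1+3u)^4}\Big)^k\pmod p.$$ (ii) If moreover $u\not\equiv -3\pmod p$, then $$\sum_{k=0}^{p-1}\binom{2k}k^2\binom{4k}{2k}\Big(\frac u{9(1+3u)^4}\Big)^k \equiv\sum_{k=0}^{p-1}\binom{2k}k^2\binom{4k}{2k}\Big(\frac{u^3}{9(3+u)^4}\Big)^k\pmod p.$$
   Context: For a prime $p$, $\mathbb{Z}_p$ denotes the set of rational numbers whose denominator is not divisible by $p$; congruences modulo $p$ are taken in $\mathbb{Z}_p$.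
   Formalization: The prime p = 3 is excluded: there the hypotheses force u ≡ 1 (mod 3) and the sums are never in Z_3 (e.g. for u = 1 the left side of (i) is 89/72), so the congruences are undefined. *)

(* Defs.v *)
From mathcomp Require Import all_boot all_order all_algebra.

Set Implicit Arguments.
Unset Strict Implicit.
Unset Printing Implicit Defensive.

Import GRing.Theory Num.Theory.

Local Open Scope ring_scope.

(* The localization of Z at p (rationals, not p-adic integers); [denq] is the
   denominator in lowest terms. *)
Definition Zloc (p : nat) : {pred rat} :=
  [pred x | ~~ (p%:Z %| denq x)%Z].

(* Congruence modulo p in [Zloc p]: both members have to be p-integral. *)
Definition congr_mod (p : nat) (x y : rat) : Prop :=
  [/\ x \in Zloc p, y \in Zloc p &
      exists2 z : rat, z \in Zloc p & x - y = p%:R * z].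

Definition a (k : nat) : nat :=
  (\sum_(0 <= j < k.+1) 'C(k, j) ^ 2 * 'C(2 * j, j))%N.

(* Main.v *)
(* Fermat's little theorem turns (1 + s u)^(-mk) into (1 + s u)^(p-1-mk) modulo
   p, and C(p-1-m, i) = (-1)^i C(m+i, i) modulo p, so both sides of (i) become
   polynomials in u of degree < p.  Up to the factor 9^n, their coefficients of
   u^n are the two sides of the identity
     sum_k C(2k,k) a_k (-9)^(n-k) C(n+k, 2k)
       = sum_k C(2k,k)^2 C(4k,2k) (-27)^(n-k) C(n+3k, 4k),
   which holds over the integers: by creative telescoping both sides satisfy
     (n+2)^3 S_(n+2) + (2n+3)(7(n+1)^2+7(n+1)+3) S_(n+1) + 81 (n+1)^3 S_n = 0.
   Part (ii) follows from (i) for u and 1/u, since u / (1 + u)^2 is invariant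
   under u -> 1/u. *)
Require Import Defs.
From mathcomp Require Import all_boot all_order all_algebra.
From mathcomp Require Import finfield ring zify.

Set Implicit Arguments.
Unset Strict Implicit.
Unset Printing Implicit Defensive.

Import GRing.Theory Num.Theory.

Local Open Scope ring_scope.

(* c ^ (n - k) / (n - k)!, with the convention 1 / m! = 0 for m < 0: the
   relations tfactSl and tfactSS then hold for all k, so that the telescoping
   sums need no boundary terms. *)
Definition tfact (c : rat) (n k : nat) : rat :=
  if (k <= n)%N then c ^+ (n - k) / ((n - k)`!)%:R else 0.

Lemma factr_neq0 n : n`!%:R != 0 :> rat.
Proof. by rewrite pnatr_eq0 -lt0n fact_gt0. Qed.

Lemma tfactSl c n k :
  (n.+1%:R - k%:R) * tfact c n.+1 k = c * tfact c n k.
Proof.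
rewrite /tfact; case: (ltngtP k n.+1) => [lt_kn|lt_nk|->]; last first.
- by rewrite subrr mul0r ltnn mulr0.
- by rewrite leqNgt (ltnW lt_nk) !mulr0.
rewrite -ltnS lt_kn -natrB ?(ltnW lt_kn) // subSn // exprS factS natrM.
have := factr_neq0 (n - k); have: (n - k).+1%:R != 0 :> rat by rewrite pnatr_eq0.
move: (_.+1%:R) (_`!%:R) => x y x0 y0; field; exact/andP.
Qed.

Lemma tfactSS c n k : tfact c n.+1 k.+1 = tfact c n k.
Proof. by rewrite /tfact ltnS subSS. Qed.

Lemma tfact_lt c n k : (n < k)%N -> tfact c n k = 0.
Proof. by rewrite /tfact ltnNge => /negbTE->. Qed.

Lemma sum_extend (V : zmodType) (F : nat -> V) m n :
  (m <= n)%N -> (forall k, (m <= k)%N -> F k = 0) ->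
  \sum_(0 <= k < m) F k = \sum_(0 <= k < n) F k.
Proof.
move=> le_mn F0; rewrite [RHS](@big_cat_nat _ _ _ m) //= [X in _ + X]big_nat_cond.
by rewrite [X in _ + X]big1 ?addr0 // => k /andP[/andP[/F0]].
Qed.

Lemma sum_telescope0 (V : zmodType) (F G : nat -> V) n :
  (forall k, F k = G k.+1 - G k) -> G 0%N = 0 -> G n = 0 ->
  \sum_(0 <= k < n) F k = 0.
Proof.
by move=> FG G0 Gn; rewrite (eq_bigr _ (fun k _ => FG k)) telescope_sumr // G0 Gn subrr.
Qed.

(** * The sequence [a] and its three-term recurrence *)

Lemma a_tfact k : (a k)%:R =
  \sum_(0 <= j < k.+1)
    k`!%:R ^+ 2 * (2 * j)`!%:R / j`!%:R ^+ 4 * tfact 1 k j ^+ 2.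
Proof.
rewrite /a natr_sum; apply: eq_big_nat => j; rewrite ltnS /= => le_jk.
rewrite /tfact le_jk expr1n natrM natrX.
have := bin_fact le_jk => /(congr1 (fun m => m%:R : rat)).
rewrite !natrM => <-.
have le_j2 : (j <= 2 * j)%N by lia.
have := bin_fact le_j2 => /(congr1 (fun m => m%:R : rat)).
have -> : (2 * j - j = j)%N by lia.
rewrite !natrM => <-.
have := factr_neq0 j; have := factr_neq0 (k - j).
move: (_`!%:R) (_`!%:R) => x y x0 y0; field; exact/andP.
Qed.

(** Creative telescoping in j: the combination of the summands [T] equals G(j+1) - G(j) for every j,
    and [G] vanishes at both ends. *)
Lemma a_rec2 k :
  k.+2%:R ^+ 2 * (a k.+2)%:R =
  (10 * k.+1%:R ^+ 2 + 10 * k.+1%:R + 3) * (a k.+1)%:R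
    - 9 * k.+1%:R ^+ 2 * (a k)%:R :> rat.
Proof.
pose T m j : rat := m`!%:R ^+ 2 * (2 * j)`!%:R / j`!%:R ^+ 4 * tfact 1 m j ^+ 2.
have aT m : (m <= k.+2)%N -> (a m)%:R = \sum_(0 <= j < k.+3) T m j.
  move=> le_mk; rewrite a_tfact; apply: sum_extend => // j lt_mj.
  by rewrite tfact_lt // expr0n mulr0.
rewrite (aT k) ?leqW // (aT k.+1) ?(aT k.+2) //; apply: subr0_eq.
rewrite !mulr_sumr -!sumrB.
(* The polynomial factor of G, here and in the two recurrences below, was found
   by undetermined coefficients. *)
pose G (j : nat) : rat := k.+1%:R ^+ 2 * (j%:R ^+ 3 * (3 * j%:R - 4 * k.+2%:R))
  * (k`!%:R ^+ 2 * (2 * j)`!%:R / j`!%:R ^+ 4 * tfact 1 k.+2 j ^+ 2).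
apply: (sum_telescope0 (G := G)) => [j||]; last 2 first.
- by rewrite /G expr0n !(mul0r, mulr0).
- by rewrite /G tfact_lt // expr0n !(mul0r, mulr0).
rewrite /G /T tfactSS.
(* All values of [tfact] become multiples of [tfact 1 k.+2 j]; what remains is an identity of
   rational functions in j and k. *)
have E1 := tfactSl 1 k.+1 j; have E0 := tfactSl 1 k j.
rewrite mul1r in E1; rewrite mul1r -{}E1 in E0.
rewrite -E0 -[tfact _ k.+1 _]mul1r -tfactSl.
have -> : (2 * j.+1 = (2 * j).+2)%N by lia.
rewrite !factS !natrM.
have := factr_neq0 j; have := factr_neq0 k.
have : j.+1%:R != 0 :> rat by rewrite pnatr_eq0.
rewrite -[k.+2%:R]natr1 -[k.+1%:R]natr1 -[j.+1%:R]natr1.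
rewrite -[(2 * j).+2%:R]natr1 -[(2 * j).+1%:R]natr1 natrM.
move: (tfact _ _ _) (_`!%:R) (_`!%:R) (_`!%:R) (j%:R) (k%:R) => t x y z i m *.
by field; apply/andP.
Qed.

(** With [k.-1] the relation also covers k = 0, where k^2 kills the last term, so it applies at
    every index of a sum over k. *)
Lemma a_rec k :
  k.+1%:R ^+ 2 * (a k.+1)%:R =
  (10 * k%:R ^+ 2 + 10 * k%:R + 3) * (a k)%:R - 9 * k%:R ^+ 2 * (a k.-1)%:R :> rat.
Proof.
case: k => [|k]; last exact: a_rec2.
have -> : a 0 = 1%N by rewrite /a big_nat1.
have -> : a 1 = 3%N by rewrite /a big_nat_recr //= big_nat1.
by ring.
Qed.

(** * The two sums and their common recurrence *)

(** (n+k)!/(k!^2 (n-k)!) = C(n,k) C(n+k,k) is the coefficient of x^k in the Legendre polynomial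
    P_n(1+2x). *)
Definition legendre_term (n k : nat) : rat :=
  (n + k)`!%:R / k`!%:R ^+ 2 * tfact (- 9) n k.

Definition quartic_term (n k : nat) : rat :=
  (n + 3 * k)`!%:R / k`!%:R ^+ 4 * tfact (- 27) n k.

(** Since a_k is not hypergeometric, the certificate [G] combines a_k and a_(k-1); [a_rec] then
    eliminates a_(k+1) from G(k+1). *)
Lemma legendre_sum_rec n :
  n.+2%:R ^+ 3 * \sum_(0 <= k < n.+3) legendre_term n.+2 k * (a k)%:R
  + (2 * n%:R + 3) * (7 * n.+1%:R ^+ 2 + 7 * n.+1%:R + 3)
    * (\sum_(0 <= k < n.+2) legendre_term n.+1 k * (a k)%:R)
  + 81 * n.+1%:R ^+ 3 * (\sum_(0 <= k < n.+1) legendre_term n k * (a k)%:R) = 0.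
Proof.
have ext m : (m <= n.+2)%N -> \sum_(0 <= k < m.+1) legendre_term m k * (a k)%:R
    = \sum_(0 <= k < n.+3) legendre_term m k * (a k)%:R.
  move=> le_mn; apply: sum_extend => // k lt_mk.
  by rewrite /legendre_term tfact_lt // mulr0 mul0r.
rewrite (ext n) ?leqW // (ext n.+1) // !mulr_sumr -!big_split /=.
pose G (k : nat) : rat := - 2 * (2 * n%:R + 3) * k%:R ^+ 2
  * (k%:R ^+ 2 * (a k)%:R + (n%:R + k%:R + 1) * (n%:R + 2 - k%:R) * (a k.-1)%:R)
  * ((n + k)`!%:R / k`!%:R ^+ 2 * tfact (- 9) n.+2 k).
apply: (sum_telescope0 (G := G)) => [k||]; last 2 first.
- by rewrite /G !(mulr0, mul0r).
- by rewrite /G tfact_lt // !mulr0.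
rewrite /G /legendre_term tfactSS /=.
have t1 : tfact (- 9) n.+1 k = (n.+2%:R - k%:R) * tfact (- 9) n.+2 k / - 9.
  by rewrite tfactSl; field.
have -> : tfact (- 9) n k = (n.+1%:R - k%:R) * tfact (- 9) n.+1 k / - 9.
  by rewrite tfactSl; field.
rewrite {}t1 addnS !addSn !factS !natrM.
have k0 : k.+1%:R != 0 :> rat by rewrite pnatr_eq0.
have -> : (a k.+1)%:R = ((10 * k%:R ^+ 2 + 10 * k%:R + 3) * (a k)%:R
    - 9 * k%:R ^+ 2 * (a k.-1)%:R) / k.+1%:R ^+ 2 :> rat.
  by rewrite -a_rec mulrAC mulfV ?mul1r // expf_neq0.
have := factr_neq0 k; move: k0.
rewrite -[(n + k).+2%:R]natr1 -[(n + k).+1%:R]natr1 natrD.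
rewrite -[n.+2%:R]natr1 -[n.+1%:R]natr1 -[k.+1%:R]natr1.
move: (tfact _ _ _) (_`!%:R) (_`!%:R) ((a k)%:R) ((a k.-1)%:R) (n%:R) (k%:R)
  => t x y b c i m *.
by field; apply/andP.
Qed.

(** Here the summand is hypergeometric, and the certificate [G] is a single hypergeometric term. *)
Lemma quartic_sum_rec n :
  n.+2%:R ^+ 3 * (\sum_(0 <= k < n.+3) quartic_term n.+2 k)
  + (2 * n%:R + 3) * (7 * n.+1%:R ^+ 2 + 7 * n.+1%:R + 3)
    * (\sum_(0 <= k < n.+2) quartic_term n.+1 k)
  + 81 * n.+1%:R ^+ 3 * (\sum_(0 <= k < n.+1) quartic_term n k) = 0.
Proof.
have ext m : (m <= n.+2)%N -> \sum_(0 <= k < m.+1) quartic_term m k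
    = \sum_(0 <= k < n.+3) quartic_term m k.
  move=> le_mn; apply: sum_extend => // k lt_mk.
  by rewrite /quartic_term tfact_lt // mulr0.
rewrite (ext n) ?leqW // (ext n.+1) // !mulr_sumr -!big_split /=.
pose G (k : nat) : rat := - 4 * (4 * n%:R + 7) * k%:R ^+ 4
  * ((n + 3 * k)`!%:R / k`!%:R ^+ 4 * tfact (- 27) n.+2 k).
apply: (sum_telescope0 (G := G)) => [k||]; last 2 first.
- by rewrite /G !(mulr0, mul0r).
- by rewrite /G tfact_lt // !mulr0.
rewrite /G /quartic_term tfactSS.
have t1 : tfact (- 27) n.+1 k = (n.+2%:R - k%:R) * tfact (- 27) n.+2 k / - 27.
  by rewrite tfactSl; field.
have -> : tfact (- 27) n k = (n.+1%:R - k%:R) * tfact (- 27) n.+1 k / - 27.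
  by rewrite tfactSl; field.
have -> : (n + 3 * k.+1 = (n + 3 * k).+3)%N by lia.
rewrite {}t1 !addSn !factS !natrM.
have k0 : k.+1%:R != 0 :> rat by rewrite pnatr_eq0.
have := factr_neq0 k; move: k0.
rewrite -[(_ + _).+3%:R]natr1 -[(_ + _).+2%:R]natr1 -[(_ + _).+1%:R]natr1 natrD natrM.
rewrite -[n.+2%:R]natr1 -[n.+1%:R]natr1 -[k.+1%:R]natr1.
move: (tfact _ _ _) (_`!%:R) (_`!%:R) (n%:R) (k%:R) => t x y i m *.
by field; apply/andP.
Qed.

Lemma legendre_quartic_sum n :
  \sum_(0 <= k < n.+1) legendre_term n k * (a k)%:R =
  \sum_(0 <= k < n.+1) quartic_term n k.
Proof.
(* The recurrence has order two, so the induction carries the claim for n and n + 1 together; its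
   leading coefficient (n+2)^3 is nonzero. *)
suff: forall m, (m <= 1)%N ->
    \sum_(0 <= k < (n + m).+1) legendre_term (n + m) k * (a k)%:R =
    \sum_(0 <= k < (n + m).+1) quartic_term (n + m) k.
  by move=> /(_ 0%N isT); rewrite addn0.
elim: n => [|n IHn] [|[|//]] _; rewrite ?addn0 ?addn1.
- by rewrite !big_nat1 /legendre_term /quartic_term /tfact /a big_nat1.
- rewrite !big_nat_recr //= !big_nil /legendre_term /quartic_term /tfact /a.
  by rewrite !big_nat_recr //= !big_nil.
- by have := IHn 1%N isT; rewrite addn1.
have := etrans (legendre_sum_rec n) (esym (quartic_sum_rec n)).
have := IHn 0%N isT; have := IHn 1%N isT; rewrite addn0 addn1 => -> ->.
move/addIr/addIr; apply: mulfI.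
by rewrite expf_neq0 // pnatr_eq0.
Qed.

(** * From factorials back to binomial coefficients *)

Lemma fact_central2 k : (2 * k)`! = ('C(2 * k, k) * k`! ^ 2)%N.
Proof.
rewrite -(@bin_fact (2 * k) k); last by lia.
by have -> : (2 * k - k = k)%N by lia.
Qed.

Lemma fact_central4 k :
  (4 * k)`! = ('C(2 * k, k) ^ 2 * 'C(4 * k, 2 * k) * k`! ^ 4)%N.
Proof.
rewrite -(@bin_fact (4 * k) (2 * k)); last by lia.
have -> : (4 * k - 2 * k = 2 * k)%N by lia.
by rewrite fact_central2; ring.
Qed.

Lemma legendre_termE n k : (k <= n)%N ->
  legendre_term n k =
  'C(2 * k, k)%:R * ((- 9) ^+ (n - k) * 'C(2 * k + (n - k), n - k)%:R).
Proof.
move=> le_kn; rewrite /legendre_term /tfact le_kn.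
have -> : (n + k = 2 * k + (n - k))%N by lia.
rewrite -(@bin_fact (2 * k + (n - k)) (n - k)) ?leq_addl // addnK.
rewrite fact_central2 !natrM.
have := factr_neq0 k; have := factr_neq0 (n - k).
by move: (_`!%:R) (_`!%:R) => x y x0 y0; field; apply/andP.
Qed.

Lemma quartic_termE n k : (k <= n)%N ->
  quartic_term n k = ('C(2 * k, k) ^ 2 * 'C(4 * k, 2 * k))%N%:R
    * ((- 27) ^+ (n - k) * 'C(4 * k + (n - k), n - k)%:R).
Proof.
move=> le_kn; rewrite /quartic_term /tfact le_kn.
have -> : (n + 3 * k = 4 * k + (n - k))%N by lia.
rewrite -(@bin_fact (4 * k + (n - k)) (n - k)) ?leq_addl // addnK.
rewrite fact_central4 mulnA natrM (natrM _ _ (k`! ^ 4)) natrM (natrX _ _ 4).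
have := factr_neq0 k; have := factr_neq0 (n - k).
by move: (_`!%:R) (_`!%:R) => x y x0 y0; field; apply/andP.
Qed.

(** Both sides are images of integers, and these agree because Z embeds in Q, where the factorial
    forms are available. *)
Lemma coef_identity (R : comRingType) n :
  \sum_(0 <= k < n.+1) ('C(2 * k, k) * a k)%N%:R
    * ((- 9) ^+ (n - k) * 'C(2 * k + (n - k), n - k)%:R) =
  \sum_(0 <= k < n.+1) ('C(2 * k, k) ^ 2 * 'C(4 * k, 2 * k))%N%:R
    * ((- 27) ^+ (n - k) * 'C(4 * k + (n - k), n - k)%:R) :> R.
Proof.
pose S (T : comRingType) (c b : nat -> nat) (x : T) :=
  \sum_(0 <= k < n.+1) (c k)%:R * (x ^+ (n - k) * (b k)%:R).
have SE (T : comRingType) c b (x : int) : (S int c b x)%:~R = S T c b x%:~R.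
  rewrite rmorph_sum; apply: eq_bigr => k _.
  by rewrite !rmorphM rmorphXn /= !rmorph_nat.
pose c1 k := ('C(2 * k, k) * a k)%N.
pose c2 k := ('C(2 * k, k) ^ 2 * 'C(4 * k, 2 * k))%N.
pose b1 k := 'C(2 * k + (n - k), n - k); pose b2 k := 'C(4 * k + (n - k), n - k).
rewrite -/(S R c1 b1 _) -/(S R c2 b2 _).
have e9 (T : comRingType) : - 9 = (- 9 : int)%:~R :> T by rewrite rmorphN /= rmorph_nat.
have e27 (T : comRingType) : - 27 = (- 27 : int)%:~R :> T by rewrite rmorphN /= rmorph_nat.
rewrite e9 e27 -!SE; congr (_%:~R); apply: (@intr_inj rat).
rewrite !SE -e9 -e27.
transitivity (\sum_(0 <= k < n.+1) legendre_term n k * (a k)%:R).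
  by apply: eq_big_nat => k /andP[_]; rewrite ltnS => le_kn;
    rewrite legendre_termE // natrM mulrAC.
rewrite legendre_quartic_sum.
by apply: eq_big_nat => k /andP[_]; rewrite ltnS => le_kn; rewrite quartic_termE.
Qed.

(** * Expansion in powers of u in characteristic p *)

Section CharP.

Variables (F : fieldType) (p : nat).
Hypotheses (p_prime : prime p) (pcharFp : p \in [pchar F]).

Lemma pnatr_eq0_dvd n : (n%:R == 0 :> F) = (p %| n)%N.
Proof. by rewrite (dvdn_pcharf pcharFp). Qed.

Lemma pnatr_neq0_lt n : (0 < n < p)%N -> n%:R != 0 :> F.
Proof.
by case/andP=> n0 ltnp; rewrite pnatr_eq0_dvd; apply: contraL ltnp => /dvdn_leq; lia.
Qed.

(** In F the number p-1-m equals -(m+1), so this is the upper negation of C(-(m+1), i); i < p allows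
    division by i! in the induction. *)
Lemma bin_complement m i : (m < p)%N -> (i < p)%N ->
  'C(p.-1 - m, i)%:R = (-1) ^+ i * 'C(m + i, i)%:R :> F.
Proof.
move=> ltmp; elim: i => [|i IHi] ltip; first by rewrite !bin0 mul1r.
have i0 : i.+1%:R != 0 :> F by apply: pnatr_neq0_lt.
apply: (mulfI i0); rewrite -natrM mul_bin_left natrM.
rewrite [RHS]mulrCA -[in RHS]natrM addnS -(mul_bin_diag (m + i).+1) natrM exprS /=.
have -> : (p.-1 - m - i)%:R * 'C(p.-1 - m, i)%:R =
    - (m + i).+1%:R * 'C(p.-1 - m, i)%:R :> F.
  (* Subtraction truncates for i > p-1-m, but then the binomial is 0. *)
  have [le_iN|/bin_small->] := leqP i (p.-1 - m); last by rewrite !mulr0.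
  congr (_ * _); apply: subr0_eq; rewrite opprK -natrD.
  have -> : (p.-1 - m - i + (m + i).+1 = p)%N by lia.
  exact: pcharf0.
rewrite IHi 1?ltnW //; ring.
Qed.

Lemma fact_dvd_p n : (p <= n)%N -> n`!%:R = 0 :> F.
Proof. by move=> lepn; apply/eqP; rewrite pnatr_eq0_dvd dvdn_fact // prime_gt0. Qed.

Lemma fact_neq0_p n : (n < p)%N -> n`!%:R != 0 :> F.
Proof.
elim: n => [|n IHn] ltnp; first exact: oner_neq0.
rewrite factS natrM mulf_neq0 //; last exact/IHn/ltnW.
exact: pnatr_neq0_lt.
Qed.

(** p divides (2k)! but not k!. *)
Lemma central2_eq0 k : (k < p <= 2 * k)%N -> 'C(2 * k, k)%:R = 0 :> F.
Proof.
case/andP=> ltkp /fact_dvd_p/eqP; rewrite fact_central2 natrM natrX.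
by rewrite mulf_eq0 expf_eq0 /= (negbTE (fact_neq0_p ltkp)) orbF => /eqP.
Qed.

Lemma central4_eq0 k : (k < p <= 4 * k)%N ->
  ('C(2 * k, k) ^ 2 * 'C(4 * k, 2 * k))%N%:R = 0 :> F.
Proof.
case/andP=> ltkp /fact_dvd_p/eqP; rewrite fact_central4 natrM (natrX _ _ 4).
by rewrite mulf_eq0 expf_eq0 /= (negbTE (fact_neq0_p ltkp)) orbF => /eqP.
Qed.

(** Replacing (1 + s u)^(-mk) by (1 + s u)^(p-1-mk) requires mk < p; the other terms vanish by the
    assumption on [c]. The k-th term then has degree k + p-1-mk < p in u, as m > 0. *)
Lemma sum_pow_expand (c : nat -> F) (m : nat) (s u : F) :
  (0 < m)%N -> (forall k, (k < p <= m * k)%N -> c k = 0) ->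
  (1 + s * u) ^+ p.-1 = 1 ->
  \sum_(0 <= k < p) c k * (u / (1 + s * u) ^+ m) ^+ k =
  \sum_(0 <= n < p) u ^+ n *
    \sum_(0 <= k < n.+1) c k * ((- s) ^+ (n - k) * 'C(m * k + (n - k), n - k)%:R).
Proof.
move=> m_gt0 c0 w1; set w := 1 + s * u in w1 *.
have w0 : w != 0.
  apply: contra_eq_neq w1 => ->; rewrite expr0n eq_sym.
  by have := prime_gt1 p_prime; case: p => [|[|q]] //= _; rewrite oner_neq0.
pose f k n := u ^+ n * (c k * ((- s) ^+ (n - k) * 'C(m * k + (n - k), n - k)%:R)).
transitivity (\sum_(0 <= k < p) \sum_(0 <= n < p | (k <= n)%N) f k n).
  apply: eq_big_nat => k /andP[_ ltkp].
  have [le_p_mk|lt_mk_p] := leqP p (m * k).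
    rewrite c0 ?ltkp // mul0r big1 // => n _.
    by rewrite /f c0 ?ltkp // mul0r mulr0.
  have -> : (u / w ^+ m) ^+ k = u ^+ k * w ^+ (p.-1 - m * k).
    rewrite expr_div_n -exprM; congr (_ * _); apply: (mulfI (expf_neq0 (m * k) w0)).
    by rewrite mulfV ?expf_neq0 // -exprD subnKC ?w1 //; lia.
  have -> : w ^+ (p.-1 - m * k) =
      \sum_(0 <= i < p - k) (- s * u) ^+ i * 'C(m * k + i, i)%:R.
    rewrite exprDn -(big_mkord xpredT
      (fun i => 1 ^+ (p.-1 - m * k - i) * (s * u) ^+ i *+ 'C(p.-1 - m * k, i))).
    (* The expansion has p - mk terms; padding with zeros up to p - k makes n = k + i run over all k
       <= n < p. *)
    rewrite (@sum_extend _ _ _ (p - k)); last 2 first.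
    - by have := leq_pmull k m_gt0; lia.
    - by move=> i lt_i; rewrite bin_small.
    apply: eq_big_nat => i /andP[_ lt_i].
    rewrite -mulr_natr bin_complement //; last by lia.
    by rewrite expr1n mul1r mulNr [in RHS]exprNn mulrCA mulrA.
  transitivity (\sum_(0 + k <= n < p) f k n); last first.
    by rewrite (@big_nat_widenl _ _ _ (0 + k) 0).
  rewrite big_addn !mulr_sumr; apply: eq_bigr => i _.
  by rewrite /f addnK exprD exprMn; ring.
rewrite (exchange_big_dep_nat xpredT) //=.
apply: eq_big_nat => n /andP[_ lt_np]; rewrite mulr_sumr.
by rewrite (big_nat_widen _ _ _ _ _ lt_np).
Qed.

End CharP.

Lemma legendre_quartic_charp (F : fieldType) (p : nat) (u : F) :
  prime p -> p \in [pchar F] -> 3%:R != 0 :> F ->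
  (1 + u) ^+ p.-1 = 1 -> (1 + 3%:R * u) ^+ p.-1 = 1 ->
  \sum_(0 <= k < p) 'C(2 * k, k)%:R * (u / (9%:R * (1 + u) ^+ 2)) ^+ k * (a k)%:R =
  \sum_(0 <= k < p) ('C(2 * k, k)%:R) ^+ 2 * 'C(4 * k, 2 * k)%:R
          * (u / (9%:R * (1 + 3%:R * u) ^+ 4)) ^+ k.
Proof.
move=> p_prime pcharFp nz3 w1 w3.
have nz9 : 9%:R != 0 :> F by rewrite (natrM _ 3 3) mulf_neq0.
have e9 (v w : F) k : (v / (9%:R * w)) ^+ k = 9%:R ^- k * (v / w) ^+ k.
  by rewrite invfM mulrCA exprMn exprVn.
pose c1 k : F := ('C(2 * k, k) * a k)%N%:R / 9%:R ^+ k.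
pose c2 k : F := ('C(2 * k, k) ^ 2 * 'C(4 * k, 2 * k))%N%:R / 9%:R ^+ k.
transitivity (\sum_(0 <= k < p) c1 k * (u / (1 + 1 * u) ^+ 2) ^+ k).
  by apply: eq_bigr => k _; rewrite e9 /c1 natrM mul1r; ring.
transitivity (\sum_(0 <= k < p) c2 k * (u / (1 + 3%:R * u) ^+ 4) ^+ k); last first.
  by apply: eq_bigr => k _; rewrite e9 /c2 natrM natrX; ring.
rewrite !(sum_pow_expand p_prime pcharFp) ?mul1r //; last 2 first.
- by move=> k hk; rewrite /c2 (central4_eq0 p_prime pcharFp hk) mul0r.
- by move=> k hk; rewrite /c1 natrM (central2_eq0 p_prime pcharFp hk) !mul0r.
apply: eq_bigr => n _; congr (_ * _).
(* Multiplication by 9^n turns 9^(-k) (-s)^(n-k) into (-9s)^(n-k): the bases are -9 for s = 1 and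
   -27 for s = 3. *)
apply: (mulfI (expf_neq0 n nz9)); rewrite !mulr_sumr.
have e (b : F) (s : F) (y : F) k : (k <= n)%N ->
    9%:R ^+ n * (b / 9%:R ^+ k * ((- s) ^+ (n - k) * y)) =
    b * ((- (9%:R * s)) ^+ (n - k) * y).
  move=> le_kn; rewrite -mulrN exprMn -{1}(subnK le_kn) exprD.
  by field; rewrite expf_neq0.
transitivity (\sum_(0 <= k < n.+1) ('C(2 * k, k) * a k)%N%:R
    * ((- 9) ^+ (n - k) * 'C(2 * k + (n - k), n - k)%:R) : F).
  by apply: eq_big_nat => k /andP[_ le_kn]; rewrite e // mulr1.
rewrite coef_identity; apply: eq_big_nat => k /andP[_ le_kn].
by rewrite e // -natrM.
Qed.

(* The reduction map from the p-integral rationals to a field of characteristic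
   p, as a relation: x = a / b and r = a / b in F, with b nonzero in F. *)
Definition residue (F : fieldType) (x : rat) (r : F) : Prop :=
  exists a b : int, [/\ b%:~R != 0 :> F, x * b%:~R = a%:~R & r * b%:~R = a%:~R].

(** * Reduction of p-integral rationals *)

Section Residue.

Variable F : fieldType.

Lemma residue_int (n : int) : residue n%:~R (n%:~R : F).
Proof. by exists n, 1; rewrite oner_neq0 !mulr1. Qed.

Lemma residue_nat n : residue n%:R (n%:R : F).
Proof. exact: (residue_int n). Qed.

Lemma residueN x (r : F) : residue x r -> residue (- x) (- r).
Proof.
by move=> [a [b [b0 xb rb]]]; exists (- a), b; rewrite !mulNr xb rb !rmorphN.
Qed.

Lemma residueD x y (r s : F) : residue x r -> residue y s -> residue (x + y) (r + s).
Proof.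
move=> [a [b [b0 xb rb]]] [c [d [d0 yd sd]]].
exists (a * d + c * b), (b * d); rewrite !(rmorphM, rmorphD) /=.
by split; rewrite ?mulf_neq0 // -?xb -?rb -?yd -?sd; ring.
Qed.

Lemma residueM x y (r s : F) : residue x r -> residue y s -> residue (x * y) (r * s).
Proof.
move=> [a [b [b0 xb rb]]] [c [d [d0 yd sd]]].
exists (a * c), (b * d); rewrite !rmorphM /=.
by split; rewrite ?mulf_neq0 // -?xb -?rb -?yd -?sd; ring.
Qed.

Lemma residueX x (r : F) n : residue x r -> residue (x ^+ n) (r ^+ n).
Proof.
move=> xr; elim: n => [|n IHn]; first exact: (residue_nat 1).
by rewrite !exprS; apply: residueM.
Qed.

(** If a / b has nonzero residue, then a is nonzero in F and b / a is an admissible fraction. *)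
Lemma residueV x (r : F) : r != 0 -> residue x r -> residue x^-1 r^-1.
Proof.
move=> r0 [a [b [b0 xb rb]]]; exists b, a.
have aF0 : a%:~R != 0 :> F by rewrite -rb mulf_neq0.
have x0 : x != 0.
  apply: contraNneq aF0 => x0; move/eqP: xb; rewrite x0 mul0r eq_sym.
  by rewrite intr_eq0 => /eqP->.
by split; rewrite -?xb -?rb ?mulKf // rb.
Qed.

Lemma residue_sum (f : nat -> rat) (g : nat -> F) m n :
  (forall k, residue (f k) (g k)) ->
  residue (\sum_(m <= k < n) f k) (\sum_(m <= k < n) g k).
Proof.
move=> fg; elim/big_ind2: _ => //; first exact: (residue_nat 0).
by move=> x r y s; apply: residueD.
Qed.

Variable p : nat.
Hypotheses (p_prime : prime p) (pcharFp : p \in [pchar F]).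

Lemma intr_eq0_dvd (n : int) : (n%:~R == 0 :> F) = (p%:Z %| n)%Z.
Proof. by rewrite (dvdz_pcharf pcharFp). Qed.

Lemma Zloc_residue x : x \in Zloc p -> exists r : F, residue x r.
Proof.
rewrite inE -intr_eq0_dvd => d0; exists ((numq x)%:~R / (denq x)%:~R).
by exists (numq x), (denq x); rewrite d0 divfK // numqE.
Qed.

(** By Gauss's lemma the reduced denominator divides b. *)
Lemma Zloc_frac x (a b : int) :
  ~~ (p%:Z %| b)%Z -> x * b%:~R = a%:~R -> x \in Zloc p.
Proof.
move=> pNb xb; rewrite inE; apply: contra pNb => /dvdz_trans; apply.
rewrite -(@Gauss_dvdzr _ (numq x)); last first.
  by rewrite coprimez_sym coprimezE coprime_num_den.
suff -> : numq x * b = a * denq x by apply: dvdz_mull.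
apply: (@intr_inj rat); rewrite !rmorphM /= numqE -xb; ring.
Qed.

Lemma residue_Zloc x (r : F) : residue x r -> x \in Zloc p.
Proof. by move=> [a [b [b0 xb _]]]; apply: Zloc_frac xb; rewrite -intr_eq0_dvd. Qed.

(** The difference is some a / b with a zero in F, so p divides a and (x - y) / p = (a / p) / b is
    p-integral. *)
Lemma residue_congr x y (r : F) : residue x r -> residue y r -> congr_mod p x y.
Proof.
move=> xr yr; split; [exact: residue_Zloc xr | exact: residue_Zloc yr |].
have [a [b [b0 xyb]]] := residueD xr (residueN yr).
rewrite subrr mul0r => /esym/eqP; rewrite intr_eq0_dvd => /dvdzP[c def_a].
have pQ : p%:R != 0 :> rat by rewrite pnatr_eq0 -lt0n prime_gt0.
exists ((x - y) / p%:R); last by rewrite mulrC divfK.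
apply: (@Zloc_frac _ c b); first by rewrite -intr_eq0_dvd.
by rewrite mulrAC xyb def_a rmorphM /= mulfK.
Qed.

End Residue.

(** * The congruences, lifted from identities in the field with p elements *)

Lemma Fp_fermat (p : nat) (x : 'F_p) : prime p -> x != 0 -> x ^+ p.-1 = 1.
Proof.
move=> p_prime x0; apply: (mulfI x0); rewrite -exprS prednK ?prime_gt0 // mulr1.
by have := expf_card x; rewrite card_Fp.
Qed.

(* p = 3 is excluded because of the factor 9 in the denominators: for p = 3 the
   sums are not in Z_(3), so that a congruence in Z_(3) makes no sense. *)
Theorem theorem4p1 (p : nat) (u : rat)
    (p_prime : prime p) (p_odd : odd p) (p_neq3 : p <> 3%N)
    (u_int : u \in Zloc p)
    (u_nz : ~ congr_mod p (u * (u + 1) * (3%:R * u + 1)) 0) :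
  congr_mod p
    (\sum_(0 <= k < p)
        'C(2 * k, k)%:R * (u / (9%:R * (1 + u) ^+ 2)) ^+ k * (a k)%:R)
    (\sum_(0 <= k < p)
        ('C(2 * k, k)%:R) ^+ 2 * 'C(4 * k, 2 * k)%:R
          * (u / (9%:R * (1 + 3%:R * u) ^+ 4)) ^+ k)
  /\
  (~ congr_mod p u (- 3%:R) ->
   congr_mod p
    (\sum_(0 <= k < p)
        ('C(2 * k, k)%:R) ^+ 2 * 'C(4 * k, 2 * k)%:R
          * (u / (9%:R * (1 + 3%:R * u) ^+ 4)) ^+ k)
    (\sum_(0 <= k < p)
        ('C(2 * k, k)%:R) ^+ 2 * 'C(4 * k, 2 * k)%:R
          * (u ^+ 3 / (9%:R * (3%:R + u) ^+ 4)) ^+ k)).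
Proof.
have pcharFp : p \in [pchar 'F_p] := pchar_Fp p_prime.
have congr x y r := @residue_congr 'F_p p p_prime pcharFp x y r.
have [r ur] := Zloc_residue pcharFp u_int.
have resn n : residue n%:R (n%:R : 'F_p) := residue_nat _ n.
have nz3 : 3%:R != 0 :> 'F_p.
  rewrite (pnatr_eq0_dvd pcharFp) dvdn_prime2 //; exact/eqP.
have nz9 : 9%:R != 0 :> 'F_p by rewrite (natrM _ 3 3) mulf_neq0.
have [r0 rp1 r3p1] : [/\ r != 0, 1 + r != 0 & 1 + 3%:R * r != 0].
  suff: r * (r + 1) * (3%:R * r + 1) != 0.
    by rewrite !mulf_eq0 !negb_or ![1 + _]addrC -andbA => /and3P[].
  apply/eqP => r_eq0; case: u_nz; apply: (congr _ _ 0); last exact: (resn 0%N).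
  rewrite -r_eq0; apply: residueM; first exact: residueM ur (residueD ur (resn 1%N)).
  exact: residueD (residueM (resn _) ur) (resn 1%N).
have res1 : residue (1 + u) (1 + r) := residueD (resn 1%N) ur.
have res3 : residue (1 + 3%:R * u) (1 + 3%:R * r).
  exact: residueD (resn 1%N) (residueM (resn _) ur).
have res_quo x y c w n : c != 0 -> residue x c -> w != 0 -> residue y w ->
    residue (x / (9%:R * y ^+ n)) (c / (9%:R * w ^+ n) : 'F_p).
  move=> c0 xc w0 yw; apply: residueM => //; apply: residueV.
    by rewrite mulf_neq0 // expf_neq0.
  by apply: residueM => //; apply: residueX.
pose Q (x : 'F_p) := \sum_(0 <= k < p)
  ('C(2 * k, k)%:R) ^+ 2 * 'C(4 * k, 2 * k)%:R * x ^+ k.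
have resQ x c : residue x c -> residue (\sum_(0 <= k < p)
    ('C(2 * k, k)%:R) ^+ 2 * 'C(4 * k, 2 * k)%:R * x ^+ k) (Q c).
  move=> xc; apply: residue_sum => k.
  by do ![apply: residueM | apply: residueX].
have partI (s : 'F_p) : 1 + s != 0 -> 1 + 3%:R * s != 0 -> \sum_(0 <= k < p)
    'C(2 * k, k)%:R * (s / (9%:R * (1 + s) ^+ 2)) ^+ k * (a k)%:R
    = Q (s / (9%:R * (1 + 3%:R * s) ^+ 4)).
  by move=> s1 s3; apply: legendre_quartic_charp => //; apply: Fp_fermat.
split=> [|u_neqN3].
  apply: (congr _ _ (Q (r / (9%:R * (1 + 3%:R * r) ^+ 4)))); last first.
    exact/resQ/res_quo.
  rewrite -partI //; apply: residue_sum => k.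
  apply: residueM; last exact: resn.
  by apply: residueM => //; apply/residueX/res_quo.
have r3 : 3%:R + r != 0.
  apply/eqP => r3; case: u_neqN3; apply: (congr _ _ r) => //.
  by have -> : r = - 3%:R; [apply/eqP; rewrite -addr_eq0 addrC r3 | apply: residueN].
apply: (congr _ _ (Q (r / (9%:R * (1 + 3%:R * r) ^+ 4)))); first exact/resQ/res_quo.
have -> : Q (r / (9%:R * (1 + 3%:R * r) ^+ 4)) = Q (r ^+ 3 / (9%:R * (3%:R + r) ^+ 4)).
  have e1 : 1 + r^-1 = (1 + r) / r by field.
  have e3 : 1 + 3%:R * r^-1 = (3%:R + r) / r by field.
  (* The right-hand argument is the quartic one at 1/r, so [partI] applies at r and at 1/r; the
     latter needs 3 + r nonzero. *)
  have <- : r^-1 / (9%:R * (1 + 3%:R * r^-1) ^+ 4) = r ^+ 3 / (9%:R * (3%:R + r) ^+ 4).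
    by rewrite e3; field; rewrite r0 r3 nz9.
  rewrite -!partI // ?e1 ?e3 ?mulf_neq0 ?invr_eq0 //.
  apply: eq_bigr => k _; congr (_ * _ ^+ _ * _).
  by field; rewrite r0 rp1 nz9.
by apply/resQ/res_quo; rewrite ?expf_neq0 //; [apply: residueX | apply: residueD].
Qed.
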